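(* Let $\mathcal{V}$ be a vector space over an algebraically closed field $\mathbb{F}$, let $\mathcal{D}:\mathcal{V}\to\mathcal{V}$ be a linear endomorphism, let $P[x]\in\mathbb{F}[x]$ be a nonzero polynomial, and let $P=P[\mathcal{D}]:\mathcal{V}\to\mathcal{V}$ be the corresponding linear operator polynomial in $\mathcal{D}$. Let $-\lambda_0,\ldots,-\lambda_\ell\in\mathbb{F}$ be the distinct solutions of $P[x]=0$ and let $p_i$ be the multiplicity of $-\lambda_i$ (there are no terms if $P[x]$ is constant). Then the solution space $\mathcal{V}_P=\{u\in\mathcal{V}: Pu=0\}$ admits a canonical and unique direct sum decomposition $$\mathcal{V}_P=\bigoplus_{i=0}^{\ell}\mathcal{V}_{\lambda_i},$$ where $\mathcal{V}_{\lambda_i}$ is the solution space (null space in $\mathcal{V}$) of $(\mathcal{D}+\lambda_i)^{p_i}$. Moreover the projection $\operatorname{Proj}_i:\mathcal{V}_P\to\mathcal{V}_{\lambda_i}$ is given by the universal formula $$\operatorname{Proj}_i=\Big[\prod_{j\neq i,\,0\le j\le \ell}(\mathcal{D}+\lambda_j)^{-p_j}_{\lambda_i}\Big]\Big[\prod_{k\neq i,\,0\le k\le\ell}(\mathcal{D}+\lambda_k)^{p_k}\Big].$$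
   Context: For $P[x]=\sum_i\kappa_i x^i$, $P[\mathcal{D}]:=\sum_i\kappa_i\mathcal{D}^i$, where $\mathcal{D}^i$ is the $i$-fold composition and $\mathcal{D}^0=\mathrm{id}_{\mathcal{V}}$. For $j\ne i$, $$(\mathcal{D}+\lambda_j)^{-1}_{\lambda_i}:=(\lambda_j-\lambda_i)^{-1}\Big(1+\frac{\mathcal{D}+\lambda_i}{\lambda_i-\lambda_j}+\cdots+\frac{(\mathcal{D}+\lambda_i)^{p_i-1}}{(\lambda_i-\lambda_j)^{p_i-1}}\Big),$$ and $(\mathcal{D}+\lambda_j)^{-p}_{\lambda_i}$ denotes the $p$-fold composition of $(\mathcal{D}+\lambda_j)^{-1}_{\lambda_i}$. Empty products are the identity. *)

(* Defs.v *)
From HB Require Import structures.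
From mathcomp Require Import all_boot all_order all_algebra.

Set Implicit Arguments.
Unset Strict Implicit.
Unset Printing Implicit Defensive.

Import GRing.Theory.
Local Open Scope ring_scope.

Section Operators.

Variables (F : fieldType) (V : lmodType F).
Implicit Types (f g D : V -> V) (a b : F) (P : {poly F}).

Definition poly_op P D : V -> V :=
  fun u => \sum_(k < size P) P`_k *: iter k D u.

Definition shift_op D a : V -> V := fun u => D u + a *: u.

(* (D + b)^{-1}_a with exponent q, the partial inverse of D + b by a truncated
   geometric series in D + a; it inverts D + b on the kernel of (D + a)^q when
   a != b. *)
Definition shift_inv D b a (q : nat) : V -> V :=
  fun u => (b - a)^-1 *:
    \sum_(k < q) ((a - b) ^+ k)^-1 *: iter k (shift_op D a) u.

Definition null_space f : {pred V} := [pred u | f u == 0].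

(* Internal direct sum of subspaces: V may be infinite dimensional, so {vspace}
   does not apply and subspaces are submod_closed predicates. *)
Definition is_direct_sum n (W : {pred V}) (Wi : 'I_n -> {pred V}) : Prop :=
  [/\ submod_closed W,
      forall i, submod_closed (Wi i),
      forall i, {subset Wi i <= W} &
      forall u, u \in W ->
        exists! w : {ffun 'I_n -> V},
          (forall i, w i \in Wi i) /\ u = \sum_i w i].

(* f restricts to the projection of W onto its i-th summand; the values of f
   outside W are irrelevant. *)
Definition is_projection n (W : {pred V}) (Wi : 'I_n -> {pred V}) (i : 'I_n) f
    : Prop :=
  forall u, u \in W ->
    f u \in Wi i /\
    forall w : {ffun 'I_n -> V},
      (forall j, w j \in Wi j) -> u = \sum_j w j -> f u = w i.

Definition proj_formula D n (lam : 'I_n -> F) (p : 'I_n -> nat) (i : 'I_n)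
    : V -> V :=
  (\big[@comp V V V/id]_(j < n | j != i)
      iter (p j) (shift_inv D (lam j) (lam i) (p i)))
  \o (\big[@comp V V V/id]_(k < n | k != i)
      iter (p k) (shift_op D (lam k))).

End Operators.

(* Main.v *)
Require Import Defs.
From HB Require Import structures.
From mathcomp Require Import all_boot all_order all_algebra.

(** The map [P |-> poly_op P D] makes [V] a module over [{poly F}], and every
operator in the theorem is multiplication by a polynomial. The decomposition is
therefore a fact about polynomials, namely the Chinese remainder theorem.

Write [f i = ('X + lam i) ^+ p i]. As [F] is algebraically closed, [P] is a
nonzero constant times the product of the pairwise coprime [f i]
([closed_poly_shift_factors]). Suppose that [E i] is congruent to [1] modulo
[f i] and divisible by all the other [f j]. Then [P] divides [f i * E i], so
[E i] sends [ker P] into [ker (f i)]; it is the identity on [ker (f i)] and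
zero on the other [ker (f j)]; and [\sum_i E i - 1] is divisible by every
[f j], hence by [P], so that the [E i u] add up to [u] on [ker P]. These facts
give existence and uniqueness of the decomposition and identify its
projections ([CRT_kernel_decomposition]).

The operator in the universal formula is multiplication by such an [E i]
([proj_polyP]). Divisibility by [f j] is visible in its second bracket. For the
congruence, the truncated geometric series defining the partial inverse of
[D + b] satisfies ['X + b] times series [= 1 - y ^+ q], where
[y = ('X + a) / (a - b)], so that it is an inverse of ['X + b] modulo
[('X + a) ^+ q] ([geom_inv_polyP]). *)

Set Implicit Arguments.
Unset Strict Implicit.
Unset Printing Implicit Defensive.

Import GRing.Theory.
Local Open Scope ring_scope.

(** * The action of polynomials in an endomorphism *)

Section PolynomialAction.

Variables (F : fieldType) (V : lmodType F) (D : {linear V -> V}).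
Implicit Types (P Q : {poly F}) (u v : V) (a b : F).

(** The sum defining [poly_op] stops at [size P]; a common longer range is what
makes sums of polynomials comparable. *)
Lemma poly_op_widen N P u :
  (size P <= N)%N -> poly_op P D u = \sum_(k < N) P`_k *: iter k D u.
Proof.
move=> leN; rewrite /poly_op (big_ord_widen _ (fun k => P`_k *: iter k D u) leN).
rewrite big_mkcond; apply: eq_bigr => k _; case: ltnP => // le_k.
by rewrite nth_default ?scale0r.
Qed.

Lemma iter_linear (g : {linear V -> V}) k : linear (iter k g).
Proof. by elim: k => // k IHk a u v; rewrite !iterS IHk linearP. Qed.

Lemma poly_op_linear P : linear (poly_op P D).
Proof.
move=> a u v; rewrite scaler_sumr -big_split; apply: eq_bigr => k _ /=.
by rewrite iter_linear scalerDr !scalerA mulrC.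
Qed.

HB.instance Definition _ P :=
  GRing.isLinear.Build F V V *:%R (poly_op P D) (poly_op_linear P).

Lemma poly_opD P Q u : poly_op (P + Q) D u = poly_op P D u + poly_op Q D u.
Proof.
set N := maxn (size P) (size Q).
rewrite (@poly_op_widen N) ?size_polyD // (@poly_op_widen N P) ?leq_maxl //.
rewrite (@poly_op_widen N Q) ?leq_maxr // -big_split.
by apply: eq_bigr => k _; rewrite coefD scalerDl.
Qed.

Lemma poly_opZ a P u : poly_op (a *: P) D u = a *: poly_op P D u.
Proof.
rewrite (@poly_op_widen (size P)) ?size_scale_leq // scaler_sumr.
by apply: eq_bigr => k _; rewrite coefZ scalerA.
Qed.

Lemma poly_op0 u : poly_op 0 D u = 0.
Proof. by have := poly_opZ 0 0 u; rewrite !scale0r. Qed.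

Lemma poly_opB P Q u : poly_op (P - Q) D u = poly_op P D u - poly_op Q D u.
Proof. by rewrite poly_opD -(scaleN1r Q) poly_opZ scaleN1r. Qed.

Lemma poly_opC a u : poly_op a%:P D u = a *: u.
Proof. by rewrite (@poly_op_widen 1) ?size_polyC_leq1 // big_ord1 coefC. Qed.

Lemma poly_op1 u : poly_op 1 D u = u.
Proof. by rewrite poly_opC scale1r. Qed.

Lemma poly_op_sum (I : finType) (A : pred I) (f : I -> {poly F}) u :
  poly_op (\sum_(i | A i) f i) D u = \sum_(i | A i) poly_op (f i) D u.
Proof.
by apply: (big_morph (fun P => poly_op P D u)) => [P Q|];
  rewrite ?poly_opD ?poly_op0.
Qed.

Lemma poly_opMX P u : poly_op (P * 'X) D u = poly_op P D (D u).
Proof.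
have [->|P0] := eqVneq P 0; first by rewrite mul0r !poly_op0.
rewrite /poly_op size_mulX // big_ord_recl coefMX scale0r add0r.
by apply: eq_bigr => k _; rewrite coefMX -iterSr.
Qed.

Lemma poly_opM P Q u : poly_op (P * Q) D u = poly_op P D (poly_op Q D u).
Proof.
elim/poly_ind: Q u => [|Q c IHQ] u; first by rewrite mulr0 !poly_op0 linear0.
rewrite mulrDr mulrA !poly_opD linearD !poly_opMX IHQ; congr (_ + _).
by rewrite mulrC mul_polyC poly_opZ poly_opC linearZ.
Qed.

Lemma poly_opX_iter P k u : poly_op (P ^+ k) D u = iter k (poly_op P D) u.
Proof.
by elim: k => [|k IHk]; rewrite ?poly_op1 // exprS poly_opM IHk.
Qed.

Lemma poly_op_shift a : poly_op ('X + a%:P) D =1 shift_op D a.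
Proof. by move=> u; rewrite poly_opD -['X]mul1r poly_opMX poly_op1 poly_opC. Qed.

Lemma poly_op_shiftX a k :
  poly_op (('X + a%:P) ^+ k) D =1 iter k (shift_op D a).
Proof. by move=> u; rewrite poly_opX_iter; apply/eq_iter/poly_op_shift. Qed.

Lemma poly_op_prod n (A : pred 'I_n) (f : 'I_n -> {poly F}) (g : 'I_n -> V -> V) :
  (forall i, poly_op (f i) D =1 g i) ->
  poly_op (\prod_(i < n | A i) f i) D =1 \big[@comp V V V/id]_(i < n | A i) g i.
Proof.
move=> fg; elim/big_rec2: _ => [u|i Q h _ IH u]; first exact: poly_op1.
by rewrite /= poly_opM fg IH.
Qed.

Lemma poly_op_dvdp P Q u : P %| Q -> poly_op P D u = 0 -> poly_op Q D u = 0.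
Proof. by case/dvdpP=> R -> Pu; rewrite poly_opM Pu linear0. Qed.

Lemma poly_op_cong1 P Q u : P %| Q - 1 -> poly_op P D u = 0 -> poly_op Q D u = u.
Proof.
by move=> PQ Pu; apply/subr0_eq; rewrite -[X in _ - X]poly_op1 -poly_opB;
  apply: poly_op_dvdp Pu.
Qed.

Lemma null_space_submod P : submod_closed (null_space (poly_op P D)).
Proof.
split=> [|a u v]; rewrite !inE; first by rewrite linear0.
by move=> /eqP Pu /eqP Pv; rewrite poly_op_linear Pu Pv scaler0 addr0.
Qed.

End PolynomialAction.

(** * Pairwise coprime factors *)

Section Coprime.

Variable F : fieldType.
Implicit Types (P Q : {poly F}).

Lemma prod_coprimep_dvdp n (f : 'I_n -> {poly F}) Q :
  (forall i j, i != j -> coprimep (f i) (f j)) ->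
  (forall i, f i %| Q) -> \prod_i f i %| Q.
Proof.
elim: n f => [|n IHn] f cop fQ; first by rewrite big_ord0 dvd1p.
rewrite big_ord_recl Gauss_dvdp ?fQ ?IHn // => [i j ne_ij|].
  by apply: cop; rewrite (inj_eq lift_inj).
elim/big_ind: _ => [|R S fR fS|i _]; first exact: coprimep1.
  by rewrite coprimepMr fR.
by apply: cop; rewrite neq_lift.
Qed.

Lemma cong1_mul P Q R : P %| Q - 1 -> P %| R - 1 -> P %| Q * R - 1.
Proof.
move=> PQ PR; rewrite (_ : Q * R - 1 = Q * (R - 1) + (Q - 1)).
  by rewrite dvdp_add ?dvdp_mull.
by rewrite mulrBr mulr1 addrA subrK.
Qed.

Lemma cong1_exp P Q k : P %| Q - 1 -> P %| Q ^+ k - 1.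
Proof.
by move=> PQ; elim: k => [|k IHk]; rewrite ?subrr ?dvdp0 // exprS cong1_mul.
Qed.

Lemma cong1_prod (I : finType) (A : pred I) P (f : I -> {poly F}) :
  (forall i, A i -> P %| f i - 1) -> P %| \prod_(i | A i) f i - 1.
Proof.
move=> Pf; elim/big_ind: _ => [|Q R|//]; first by rewrite subrr dvdp0.
exact: cong1_mul.
Qed.

(** Shape taken by the Chinese remainder theorem in a module: the idempotents
[E i] modulo [\prod_i f i] act on the kernel of the product as the projections
onto the kernels of the factors. *)
Theorem CRT_kernel_decomposition (V : lmodType F) (D : {linear V -> V}) P
    n (f E : 'I_n -> {poly F}) :
  (forall i j, i != j -> coprimep (f i) (f j)) ->
  P %= \prod_i f i ->
  (forall i, f i %| E i - 1) ->
  (forall i j, j != i -> f j %| E i) ->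
  let W := null_space (poly_op P D) in
  let Wi := fun i => null_space (poly_op (f i) D) in
  is_direct_sum W Wi /\ forall i, is_projection W Wi i (poly_op (E i) D).
Proof.
move=> cop eqP1 E1 E0 W Wi.
have P_dvd Q : (forall i, f i %| Q) -> P %| Q.
  by move=> fQ; rewrite (eqp_dvdl _ eqP1) prod_coprimep_dvdp.
have f_dvd i : f i %| P by rewrite (eqp_dvdr _ eqP1) (bigD1 i) //= dvdp_mulr.
have E_in i u : u \in W -> poly_op (E i) D u \in Wi i.
  rewrite !inE -poly_opM => /eqP Pu; apply/eqP/(poly_op_dvdp _ Pu)/P_dvd => j.
  by have [->|ne_ji] := eqVneq j i; [rewrite dvdp_mulr | rewrite dvdp_mull ?E0].
have E_sum u : u \in W -> u = \sum_i poly_op (E i) D u.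
  move=> /eqP Pu; rewrite -poly_op_sum (poly_op_cong1 _ Pu) // P_dvd // => j.
  rewrite (bigD1 j) //= addrAC dvdp_add ?E1 //.
  by apply: (big_ind (fun Q => f j %| Q)) => [|Q R|i];
    [exact: dvdp0 | exact: dvdp_add | rewrite eq_sym; apply: E0].
have E_proj i (w : {ffun 'I_n -> V}) :
    (forall j, w j \in Wi j) -> poly_op (E i) D (\sum_j w j) = w i.
  move=> wW; have fw j : poly_op (f j) D (w j) = 0 by apply/eqP/wW.
  rewrite linear_sum (bigD1 i) //= (poly_op_cong1 (E1 i)) // big1 ?addr0 //.
  by move=> j ne_ji; apply: poly_op_dvdp (fw j); apply: E0.
split; last by move=> i u uW; split=> [|w wW ->]; [apply: E_in | apply: E_proj].
split=> [|i|i u /eqP fu|u uW]; try exact: null_space_submod.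
  by apply/eqP; apply: poly_op_dvdp fu.
exists [ffun i => poly_op (E i) D u]; split=> [|w [wW ->]].
  split=> [i|]; first by rewrite ffunE E_in.
  by rewrite {1}(E_sum u uW); apply: eq_bigr => i _; rewrite ffunE.
by apply/ffunP=> i; rewrite ffunE E_proj.
Qed.

End Coprime.

(** * The universal projection formula as a polynomial *)

Section ProjectionPolynomial.

Variable F : fieldType.
Implicit Types (a b : F) (q : nat).

Definition geom_inv_poly b a q : {poly F} :=
  (b - a)^-1 *: \sum_(k < q) ((a - b) ^+ k)^-1 *: ('X + a%:P) ^+ k.

Lemma poly_op_geom_inv (V : lmodType F) (D : {linear V -> V}) b a q :
  poly_op (geom_inv_poly b a q) D =1 shift_inv D b a q.
Proof.
move=> u; rewrite poly_opZ poly_op_sum; congr (_ *: _).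
by apply: eq_bigr => k _; rewrite poly_opZ poly_op_shiftX.
Qed.

(** With [y = ('X + a) / (a - b)], the product telescopes to [1 - y ^+ q], and
[y ^+ q] is a scalar multiple of the modulus. *)
Lemma geom_inv_polyP b a q :
  a != b -> ('X + a%:P) ^+ q %| geom_inv_poly b a q * ('X + b%:P) - 1.
Proof.
move=> ne_ab; pose y : {poly F} := (a - b)^-1 *: ('X + a%:P).
have ab0 : a - b != 0 by rewrite subr_eq0.
have Xb : 'X + b%:P = (a - b) *: (y - 1).
  rewrite scalerBr scalerA divff // scale1r alg_polyC polyCB opprB.
  by rewrite -addrA [a%:P + _]addrC subrK.
have -> : geom_inv_poly b a q = - (a - b)^-1 *: \sum_(k < q) y ^+ k.
  rewrite /geom_inv_poly -opprB invrN; congr (_ *: _).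
  by apply: eq_bigr => k _; rewrite exprZn exprVn.
rewrite Xb -scalerAl -scalerAr scalerA mulNr mulVf // scaleN1r mulrC -subrX1.
by rewrite opprB addrAC subrr add0r dvdpNr exprZn dvdpZr ?expf_neq0 ?invr_eq0.
Qed.

Definition proj_poly n (lam : 'I_n -> F) (p : 'I_n -> nat) (i : 'I_n) :=
  (\prod_(j < n | j != i) geom_inv_poly (lam j) (lam i) (p i) ^+ p j) *
  (\prod_(k < n | k != i) ('X + (lam k)%:P) ^+ p k).

Lemma poly_op_proj_poly (V : lmodType F) (D : {linear V -> V})
    n (lam : 'I_n -> F) p i :
  poly_op (proj_poly lam p i) D =1 proj_formula D lam p i.
Proof.
move=> u; rewrite poly_opM /proj_formula /=.
rewrite (poly_op_prod _ (fun k => poly_op_shiftX D (lam k) (p k))).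
apply: poly_op_prod => j v; rewrite poly_opX_iter.
exact/eq_iter/poly_op_geom_inv.
Qed.

Lemma proj_polyP n (lam : 'I_n -> F) p (lam_inj : injective lam) i :
  ('X + (lam i)%:P) ^+ p i %| proj_poly lam p i - 1 /\
  forall j, j != i -> ('X + (lam j)%:P) ^+ p j %| proj_poly lam p i.
Proof.
split=> [|j ne_ji]; last first.
  by rewrite dvdp_mull // (bigD1 j) //= dvdp_mulr.
rewrite /proj_poly -big_split; apply: cong1_prod => j ne_ji.
by rewrite /= -exprMn cong1_exp // geom_inv_polyP // (inj_eq lam_inj) eq_sym.
Qed.

Lemma coprimep_shiftX n (lam : 'I_n -> F) p (lam_inj : injective lam) i j :
  i != j -> coprimep (('X + (lam i)%:P) ^+ p i) (('X + (lam j)%:P) ^+ p j).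
Proof.
move=> ne_ij; rewrite coprimep_expl // coprimep_expr //.
rewrite -[lam i]opprK -[lam j]opprK !(polyCN (- _)).
by rewrite coprimep_XsubC2 // opprK addrC subr_eq0 (inj_eq lam_inj).
Qed.

End ProjectionPolynomial.

(** The cofactor of the product in [P] has no root, because a root would be some
[- lam i] and raise its multiplicity above [p i]; over an algebraically closed
field it is then constant. *)
Lemma closed_poly_shift_factors (F : closedFieldType) (P : {poly F})
    n (lam : 'I_n -> F) (p : 'I_n -> nat) :
  P != 0 -> injective lam ->
  (forall x, root P x -> exists i, x = - lam i) ->
  (forall i, p i = mup (- lam i) P) ->
  P %= \prod_i ('X + (lam i)%:P) ^+ p i.
Proof.
move=> P0 lam_inj roots mult; set R := \prod_i _.
have shiftE i : 'X + (lam i)%:P = 'X - (- lam i)%:P.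
  by rewrite polyCN opprK.
have /dvdpP [Q PE] : R %| P.
  apply: prod_coprimep_dvdp => [i j|i]; first exact: coprimep_shiftX.
  by rewrite shiftE -mup_geq // mult.
suff Q1 : size Q = 1%N.
  by rewrite PE -[X in _ %= X]mul1r eqp_mul2r -?size_poly_eq1 ?Q1 //;
    apply: contraNneq P0; rewrite PE => ->; rewrite mulr0.
apply/eqP/negPn/negP => /closed_rootP [x Qx].
have [i xE] : exists i, x = - lam i by apply: roots; rewrite PE rootM Qx.
have := mup_ltn (- lam i) (mup (- lam i) P).+1 P0; rewrite ltnSn => /esym/negP.
case; rewrite -mult {1}PE (_ : R = ('X + (lam i)%:P) ^+ p i *
  \prod_(j | j != i) ('X + (lam j)%:P) ^+ p j); last by rewrite /R (bigD1 i).
by rewrite mulrA dvdp_mulr // exprS -shiftE dvdp_mul // shiftE dvdp_XsubCl -xE.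
Qed.

Theorem theorem1p1 (F : closedFieldType) (V : lmodType F)
    (D : {linear V -> V}) (P : {poly F}) (P_neq0 : P != 0)
    (n : nat) (lam : 'I_n -> F) (p : 'I_n -> nat)
    (lam_inj : injective lam)
    (lam_roots : forall x : F, root P x <-> exists i : 'I_n, x = - lam i)
    (p_mult : forall i : 'I_n, p i = mup (- lam i) P) :
  let VP : {pred V} := null_space (poly_op P D) in
  let Vlam : 'I_n -> {pred V} :=
    fun i => null_space (iter (p i) (shift_op D (lam i))) in
  is_direct_sum VP Vlam /\
  forall i : 'I_n, is_projection VP Vlam i (proj_formula D lam p i).
Proof.
move=> VP Vlam.
pose f i : {poly F} := ('X + (lam i)%:P) ^+ p i.
pose Wi i : {pred V} := null_space (poly_op (f i) D).
(* The two predicates agree only pointwise, so membership is transported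
   clause by clause below. *)
have WE i u : (u \in Vlam i) = (u \in Wi i) by rewrite !inE poly_op_shiftX.
have [[VPs Ws WP dec] proj] : is_direct_sum VP Wi /\
    forall i, is_projection VP Wi i (poly_op (proj_poly lam p i) D).
  apply: CRT_kernel_decomposition => [i j|||].
  - exact: coprimep_shiftX.
  - by apply: closed_poly_shift_factors => // x /lam_roots.
  - by move=> i; case: (proj_polyP p lam_inj i).
  - by move=> i; case: (proj_polyP p lam_inj i).
split; first split=> // [i|i u|u uVP].
- have [W0 WD] := Ws i; split=> [|a u v]; first by rewrite WE.
  by rewrite !WE; apply: WD.
- by rewrite WE; apply: WP.
- have [w [[wW uE] w_uniq]] := dec u uVP; exists w; split.
    by split=> // i; rewrite WE.
  by move=> w' [w'W uE']; apply: w_uniq; split=> // i; rewrite -WE.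
move=> i u uVP; have [pW pE] := proj i u uVP.
rewrite -poly_op_proj_poly WE; split=> // w wW uE.
by apply: pE => // j; rewrite -WE.
Qed.
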